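(* Let $e$ be a positive integer and let $n\in\mathbb{N}$. Then the symmetric function $W_n^{(e)}$ is Schur positive.
   Context: Let $\Lambda$ be the ring of symmetric functions in $x_1,x_2,\ldots$, with Schur functions $s_\lambda$ and monomial symmetric functions $m_\lambda$. Let $\mu_e\subset\mathbb{C}$ be the set of $e$-th roots of $1$. For $n\in\mathbb{N}$ define the symmetric polynomial $$W_n^{(e)}(x_1,\dotsc,x_r)=\frac{1}{e^r}\sum_{\zeta_1,\dotsc,\zeta_r\in\mu_e}\left(\sum_{i=1}^r \zeta_i\sqrt[e]{x_i}\right)^{en},$$ where $\sqrt[e]{x_i}$ is any fixed $e$-th root of $x_i$ (the result does not depend on the choice and is a polynomial in the $x_i$). Taking the inverse limit over $r$ defines a symmetric function $W_n^{(e)}\in\Lambda$, homogeneous of degree $n$. Equivalently, $$W_n^{(e)}=\sum_{\lambda\vdash n}\binom{en}{e\lambda}m_\lambda,$$ where $e\lambda=(e\lambda_1,e\lambda_2,\ldots)$ and $\binom{en}{e\lambda}=\frac{(en)!}{\prod_i (e\lambda_i)!}$ is a multinomial coefficient. A symmetric function is Schur positive if all coefficients in its expansion in the basis of Schur functions $s_\lambda$ are nonnegative. *)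

(* Defs.v *)
From HB Require Import structures.
From mathcomp Require Import all_boot all_order all_algebra all_fingroup.
From mathcomp Require Import cyclic separable cyclotomic finmap mpoly ring.

Set Implicit Arguments.
Unset Strict Implicit.
Unset Printing Implicit Defensive.

Import Order.TTheory GRing.Theory Num.Theory.

Local Open Scope ring_scope.

(** * Symmetric functions *)

(* Elements of Lambda, the inverse limit of the rings of symmetric polynomials
   in r variables, taken in the category of graded rings (hence the uniform
   bound on the degree).  The transition map sends the last variable to 0. *)
Record symfun (R : comNzRingType) := SymFun {
  sympoly :> forall r : nat, {mpoly R[r]};
  sympoly_sym : forall r : nat, sympoly r \is symmetric;
  sympoly_stable : forall r : nat,
    sympoly r.+1 \mPo [tuple of rcons [tuple 'X_i | i < r] 0] = sympoly r;
  sympoly_bounded : exists d : nat, forall r : nat, (msize (sympoly r) <= d)%N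
}.

(** * Partitions and Schur functions *)

Definition is_intpart : pred (seq nat) :=
  fun la => sorted geq la && (0%N \notin la).

Definition intpart : choiceType := {la : seq nat | is_intpart la}.

Section Schur.
Variables (R : comNzRingType) (la : seq nat) (r : nat).

(* The cell in row i and column j of the diagram, both counted from 0, is
   [Tagged _ j] with [tag] i. *)
Definition cell : finType := {i : 'I_(size la) & 'I_(nth 0%N la i)}.
Definition crow (x : cell) : nat := tag x.
Definition ccol (x : cell) : nat := tagged x.

(* Semistandard tableaux: rows weakly increase, columns strictly increase. *)
Definition semistandard (T : {ffun cell -> 'I_r}) : bool :=
  [forall x : cell, forall y : cell,
    ((crow x == crow y) && (ccol x < ccol y)%N ==> (T x <= T y)%N) &&
    ((ccol x == ccol y) && (crow x < crow y)%N ==> (T x < T y)%N)].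

Definition schur : {mpoly R[r]} :=
  \sum_(T : {ffun cell -> 'I_r} | semistandard T) \prod_(x : cell) 'X_(T x).

End Schur.

(* Equality in the inverse limit is equality in every number of variables;
   the coefficients c do not depend on that number. *)
Definition schur_expansion (R : comNzRingType) (f : symfun R)
    (c : {fsfun intpart -> R with 0}) : Prop :=
  forall r : nat,
    f r = \sum_(la <- finsupp c) c la *: schur R (val la) r.

Definition schur_positive (R : numDomainType) (f : symfun R) : Prop :=
  exists c : {fsfun intpart -> R with 0},
    schur_expansion f c /\ forall la : intpart, 0 <= c la.

(** * The symmetric functions W *)

Section RootsOfUnity.
Variable C : numClosedFieldType.

(* All the roots of X^e - 1; see [mem_mu] and [uniq_mu]. *)
Definition mu (e : nat) : seq C :=
  sval (closed_field_poly_normal ('X^e - 1 : {poly C})).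

Variable e : nat.
Hypothesis e_gt0 : (0 < e)%N.

Let muE : 'X^e - 1 = \prod_(z <- mu e) ('X - z%:P).
Proof.
rewrite {1}[LHS](svalP (closed_field_poly_normal ('X^e - 1 : {poly C}))).
by rewrite -/(mu e) -polyC1 (monicP (monicXnsubC _ e_gt0)) scale1r.
Qed.

Lemma mem_mu (z : C) : (z \in mu e) = (z ^+ e == 1).
Proof. by rewrite -root_prod_XsubC -muE rootE !hornerE subr_eq0. Qed.

Lemma uniq_mu : uniq (mu e).
Proof.
rewrite -separable_prod_XsubC -muE separable_Xn_sub_1 //.
by rewrite pnatr_eq0 -lt0n.
Qed.

Lemma size_mu : size (mu e) = e.
Proof.
by apply: succn_inj; rewrite -(size_prod_XsubC _ id) -muE -polyC1 size_XnsubC.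
Qed.

Lemma sum_mu (k : nat) :
  \sum_(z : seq_sub (mu e)) ssval z ^+ k = if (e %| k)%N then e%:R else 0.
Proof.
have [w w_prim] : exists w : C, e.-primitive_root w.
  have : has e.-primitive_root (mu e).
    apply: has_prim_root; rewrite ?uniq_mu ?size_mu //.
    by apply/allP => z; rewrite mem_mu unity_rootE.
  by case/hasP => w _ ?; exists w.
have [dvd_ek|ndvd_ek] := boolP (e %| k)%N.
  rewrite (eq_bigr (fun=> 1)) => [|z _]; last first.
    have := ssvalP z; rewrite mem_mu => /eqP ze1.
    by case/dvdnP: dvd_ek => q ->; rewrite mulnC exprM ze1 expr1n.
  by rewrite sumr_const card_seq_sub ?uniq_mu // size_mu.
have wk_neq1 : w ^+ k != 1 by rewrite -(prim_order_dvd w_prim).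
have w_unit : w \is a GRing.unit.
  rewrite unitfE; apply: contra_eq_neq (prim_expr_order w_prim) => ->.
  by rewrite expr0n gtn_eqF // eq_sym oner_neq0.
have w_mu (z : C) : z \in mu e -> w * z \in mu e.
  by rewrite !mem_mu exprMn (prim_expr_order w_prim) mul1r.
pose h (z : seq_sub (mu e)) : seq_sub (mu e) := SeqSub (w_mu _ (ssvalP z)).
have h_inj : injective h.
  by move=> x y /(congr1 (@ssval _ _)) /= /(mulrI w_unit) /val_inj.
set S := LHS; have S_eq : S = w ^+ k * S.
  rewrite {1}/S (reindex_inj h_inj) /= mulr_sumr.
  by apply: eq_bigr => z _; rewrite exprMn.
apply/eqP; move/eqP: S_eq; rewrite -{1}[S]mul1r -subr_eq0 -mulrBl mulf_eq0.
by rewrite subr_eq0 eq_sym (negbTE wk_neq1).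
Qed.

End RootsOfUnity.

Section PowerSum.
Variable R : fieldType.
Hypothesis charR : forall n, (n.+1)%:R != 0 :> R.

Lemma mcoeffMXU r (p : {mpoly R[r]}) (i : 'I_r) (m : 'X_{1..r}) :
  (p * 'X_i)@_m = if m i == 0%N then 0 else p@_(m - U_(i)).
Proof.
case: ifPn => [mi0|mi0]; last first.
  have /submK {1}<- : (U_(i) <= m)%MM by rewrite lep1mP.
  by rewrite addmC mcoeffMX.
apply/eqP; rewrite mcoeff_eq0 (perm_mem (msuppMX _ _)).
apply/negP => /mapP [m' _ E]; move: mi0.
by rewrite E mnmDE mnm1E eqxx add1n.
Qed.

Let fact_neq0 n : (n`!)%:R != 0 :> R.
Proof. by case: (n`!)%N (fact_gt0 n) => // k _; apply: charR. Qed.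

Lemma mcoeff_linexp r (a : 'I_r -> R) (N : nat) (m : 'X_{1..r}) :
  ((\sum_i a i *: 'X_i) ^+ N)@_m =
  if mdeg m == N then
    (N`!)%:R / (\prod_i ((m i)`!)%N)%:R * \prod_i a i ^+ m i
  else 0.
Proof.
have prodf_neq0 (m' : 'X_{1..r}) : (\prod_i ((m' i)`!)%N)%:R != 0 :> R.
  by rewrite natr_prod; apply/prodf_neq0.
elim: N m => [|N IHN] m.
  rewrite expr0 mcoeff1 mdeg_eq0; case: eqP => [->|//].
  rewrite !big1 ?fact0 ?divr1 ?mulr1 // => i _; rewrite mnm0E //.
rewrite exprSr mulr_sumr raddf_sum /=.
have step i : ((\sum_i a i *: 'X_i) ^+ N * (a i *: 'X_i))@_m =
    if mdeg m == N.+1 then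
      (N`!)%:R / (\prod_i ((m i)`!)%N)%:R * \prod_i a i ^+ m i * (m i)%:R
    else 0.
  rewrite -scalerAr mcoeffZ mcoeffMXU.
  have [->|mi0] := eqVneq (m i) 0%N; first by rewrite !mulr0 if_same.
  have le_im : (U_(i) <= m)%MM by rewrite lep1mP.
  have -> : mdeg m = (mdeg (m - U_(i))).+1.
    by rewrite -{1}(submK le_im) mdegD mdeg1 addn1.
  rewrite IHN eqSS.
  case: ifP => _; last by rewrite mulr0.
  set m' := (m - U_(i))%MM.
  have mi : m i = (m' i).+1 by rewrite mnmBE mnm1E eqxx subn1 prednK ?lt0n.
  have mj j : j != i -> m' j = m j.
    by move=> ji; rewrite mnmBE mnm1E eq_sym (negbTE ji) subn0.
  have Ef : (\prod_j (m j)`! = m i * \prod_j (m' j)`!)%N.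
    rewrite (bigD1 i) //= [in RHS](bigD1 i) //= mulnA; congr (_ * _)%N.
      by rewrite mi factS.
    by apply: eq_bigr => j /mj ->.
  have Ea : \prod_j a j ^+ m j = a i * \prod_j a j ^+ m' j.
    rewrite (bigD1 i) //= [in RHS](bigD1 i) //= mulrA; congr (_ * _).
      by rewrite mi exprS.
    by apply: eq_bigr => j /mj ->.
  have minz : (m i)%:R != 0 :> R by rewrite mi charR.
  move: (prodf_neq0 m') minz; rewrite Ef Ea natrM.
  move: (_%:R) (_%:R) (_%:R) (\prod_j _) => x y z t z_neq0 y_neq0.
  by field; apply/andP; split.
rewrite (eq_bigr _ (fun i _ => step i)); case: eqP => [Em|_]; last first.
  by rewrite big1.
rewrite -mulr_sumr -natr_sum -mdegE Em factS natrM.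
by move: (_%:R) (_%:R^-1) (_%:R) (\prod_i _) => x y z t; ring.
Qed.

End PowerSum.

Section W.
Variable C : numClosedFieldType.

(* The average over mu_e^r of (zeta_1 y_1 + ... + zeta_r y_r)^(e n), where y_i
   stands for the e-th root of x_i. *)
Definition Wroot (e n r : nat) : {mpoly C[r]} :=
  (e%:R ^- r) *:
    \sum_(zeta : {ffun 'I_r -> seq_sub (mu C e)})
      (\sum_(i < r) ssval (zeta i) *: 'X_i) ^+ (e * n).

(* [Wroot e n r] is a polynomial in the y_i^e, homogeneous of degree n in
   them; [Wpoly e n r] is obtained by replacing each y_i^e by x_i, i.e., each
   monomial y^(e m) by x^m.  See [Wpoly_root] and [Wpoly_meval]. *)
Definition Wpoly (e n r : nat) : {mpoly C[r]} :=
  \sum_(m : 'X_{1..r < n.+1}) (Wroot e n r)@_(m *+ e) *: 'X_[m].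

Variables (e n : nat).
Hypothesis e_gt0 : (0 < e)%N.

Lemma mcoeff_Wroot r (m : 'X_{1..r}) :
  (Wroot e n r)@_m =
  if (mdeg m == e * n)%N && [forall i, e %| m i]%N then
    ((e * n)`!)%:R / (\prod_i ((m i)`!)%N)%:R
  else 0.
Proof.
have charC k : (k.+1)%:R != 0 :> C by rewrite pnatr_eq0.
rewrite mcoeffZ raddf_sum /=.
under eq_bigr do rewrite (mcoeff_linexp charC).
case: (mdeg m == _) => /=; last by rewrite big1 ?mulr0.
rewrite -mulr_sumr.
have -> : \sum_(zeta : {ffun 'I_r -> seq_sub (mu C e)})
      \prod_i ssval (zeta i) ^+ m i =
    \prod_i (if (e %| m i)%N then e%:R else 0 : C).
  rewrite -(bigA_distr_bigA (fun i (z : seq_sub (mu C e)) => ssval z ^+ m i)).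
  by apply: eq_bigr => i _; exact: sum_mu.
case: ifPn => [/forallP dvd_m|].
  rewrite [X in _ * (_ * X)](eq_bigr (fun=> e%:R)) => [|i _]; last first.
    by rewrite dvd_m.
  rewrite prodr_const card_ord mulrC mulfK //.
  by rewrite expf_neq0 // pnatr_eq0 -lt0n.
case/forallPn => i /negbTE ndvd_i.
by rewrite [X in _ * (_ * X)](bigD1 i) //= ndvd_i mul0r !mulr0.
Qed.

(* The expansion of W in monomial symmetric functions, read off coefficientwise. *)
Lemma mcoeff_Wpoly r (m : 'X_{1..r}) :
  (Wpoly e n r)@_m =
  if mdeg m == n then
    ((e * n)`!)%:R / (\prod_i ((e * m i)`!)%N)%:R
  else 0.
Proof.
have WE k : (mdeg k < n.+1)%N -> (Wpoly e n r)@_k = (Wroot e n r)@_(k *+ e).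
  by move=> lt_kn; rewrite (mcoeff_mpoly (fun k => (Wroot e n r)@_(k *+ e))).
have [lt_mn|ge_mn] := ltnP (mdeg m) n.+1; last first.
  rewrite gtn_eqF // raddf_sum big1 //= => k _.
  rewrite mcoeffZ mcoeffX; case: eqP => [E|_]; last by rewrite mulr0.
  by have := bmdeg k; rewrite E ltnNge ge_mn.
rewrite WE // mcoeff_Wroot mdegMn mulnC eqn_pmul2l //.
have -> : [forall i, e %| (m *+ e)%MM i]%N.
  by apply/forallP => i; rewrite mulmnE dvdn_mull.
rewrite andbT; case: eqP => // _; congr (_ / _%:R).
by apply: eq_bigr => i _; rewrite mulmnE mulnC.
Qed.

Lemma Wpoly_homog r : Wpoly e n r \is n.-homog.
Proof.
apply/dhomogP => m; rewrite mcoeff_msupp mcoeff_Wpoly.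
by have [//|_] := eqVneq (mdeg m) n; rewrite eqxx.
Qed.

Lemma Wpoly_root r :
  Wpoly e n r \mPo [tuple 'X_i ^+ e | i < r] = Wroot e n r.
Proof.
have XE (m : 'X_{1..r}) :
    'X_[m] \mPo [tuple 'X_i ^+ e | i < r] = 'X_[m *+ e] :> {mpoly C[r]}.
  rewrite comp_mpolyX [RHS]mpolyXE_id.
  by apply: eq_bigr => i _; rewrite tnth_mktuple mulmnE mulnC exprM.
apply/mpolyP => m; rewrite /Wpoly (raddf_sum (comp_mpoly _)) raddf_sum /=.
under eq_bigr do rewrite comp_mpolyZ XE mcoeffZ mcoeffX.
have [/forallP dvd_m|ndvd_m] := boolP [forall i, e %| m i]%N; last first.
  rewrite mcoeff_Wroot (negbTE ndvd_m) andbF big1 // => k _.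
  case: eqP => [E|_]; last by rewrite mulr0.
  case/negP: ndvd_m; apply/forallP => i.
  by rewrite -E mulmnE dvdn_mull.
pose k := [multinom (m i %/ e)%N | i < r].
have km : (k *+ e)%MM = m.
  by apply/mnmP => i; rewrite mulmnE mnmE divnK.
have [lt_kn|ge_kn] := ltnP (mdeg k) n.+1.
  rewrite (bigD1 (Sub k lt_kn)) //= km eqxx mulr1 big1 ?addr0 // => k' ne_k.
  case: eqP => [E|_]; last by rewrite mulr0.
  case/eqP: ne_k; apply: val_inj => /=; apply/mnmP => i.
  by rewrite mnmE -E mulmnE mulnK.
rewrite mcoeff_Wroot big1 => [|k' _].
  by rewrite -km mdegMn mulnC eqn_pmul2l // gtn_eqF.
case: eqP => [E|_]; last by rewrite mulr0.
have := bmdeg k'; rewrite ltnNge -(leq_pmul2r e_gt0) -mdegMn E -km mdegMn.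
by rewrite leq_pmul2r // ge_kn.
Qed.

(* The defining formula, for any choice y_i of an e-th root of each x_i. *)
Lemma Wpoly_meval r (x y : 'I_r -> C) : (forall i, y i ^+ e = x i) ->
  (Wpoly e n r).@[x] =
  e%:R ^- r * \sum_(zeta : {ffun 'I_r -> seq_sub (mu C e)})
    (\sum_(i < r) ssval (zeta i) * y i) ^+ (e * n).
Proof.
move=> yx; have <- : (Wroot e n r).@[y] = (Wpoly e n r).@[x].
  rewrite -Wpoly_root comp_mpoly_meval; apply: meval_eq => i.
  by rewrite tnth_mktuple rmorphXn /= mevalXU.
rewrite mevalZ raddf_sum; congr (_ * _); apply: eq_bigr => zeta _ /=.
rewrite rmorphXn raddf_sum /=; congr (_ ^+ _); apply: eq_bigr => i _.
by rewrite mevalZ mevalXU.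
Qed.

Lemma Wpoly_sym r : Wpoly e n r \is symmetric.
Proof.
apply/issymP => s; apply/mpolyP => m.
rewrite mcoeff_sym !mcoeff_Wpoly.
have -> : mdeg [multinom m (s i) | i < r] = mdeg m.
  rewrite !mdegE [RHS](reindex_inj (@perm_inj _ s)).
  by apply: eq_bigr => i _; rewrite mnmE.
case: ifP => // _; congr (_ / _%:R).
rewrite [RHS](reindex_inj (@perm_inj _ s)).
by apply: eq_bigr => i _; rewrite mnmE.
Qed.

Lemma mcoeff_comp_last0 r (p : {mpoly C[r.+1]}) (m : 'X_{1..r}) :
  (p \mPo [tuple of rcons [tuple 'X_i | i < r] 0])@_m = p@_(mnmwiden m).
Proof.
set lq := [tuple of _].
have lqW i : tnth lq (widen_ord (leqnSn r) i) = 'X_i.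
  rewrite (tnth_nth 0) /= nth_rcons size_map size_enum_ord ltn_ord.
  by rewrite (nth_map i) ?size_enum_ord // nth_ord_enum.
have lqM : tnth lq ord_max = 0.
  rewrite (tnth_nth 0) /= nth_rcons size_map size_enum_ord.
  by rewrite ltnn eqxx.
have XE (k : 'X_{1..r.+1}) : ('X_[k] \mPo lq)@_m = (k == mnmwiden m)%:R.
  rewrite comp_mpolyX big_ord_recr /= lqM.
  under eq_bigr do rewrite lqW.
  have [k0|k_gt0] := posnP (k ord_max); last first.
    rewrite expr0n gtn_eqF // mulr0 mcoeff0; case: eqP => // E.
    by move: k_gt0; rewrite E mnmwiden_ordmax.
  rewrite k0 expr0 mulr1.
  pose k' := [multinom k (widen_ord (leqnSn r) i) | i < r].
  have kE : k = mnmwiden k'.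
    apply/mnmP => i; case: (unliftP ord_max i) => [j|] ->; last first.
      by rewrite k0 mnmwiden_ordmax.
    have -> : lift ord_max j = widen_ord (leqnSn r) j.
      by apply: val_inj; rewrite /= /bump leqNgt ltn_ord.
    by rewrite mnmwiden_widen mnmE.
  rewrite (_ : \prod_(i < r) _ = 'X_[k']) ?mcoeffX.
    by rewrite kE (inj_eq (@inj_mnmwiden r)).
  by rewrite mpolyXE_id; apply: eq_bigr => i _; rewrite mnmE.
rewrite comp_mpolyEX raddf_sum /= [in RHS](mpolyE p) raddf_sum /=.
by apply: eq_bigr => k _; rewrite !mcoeffZ XE mcoeffX.
Qed.

Lemma Wpoly_stable r :
  Wpoly e n r.+1 \mPo [tuple of rcons [tuple 'X_i | i < r] 0] = Wpoly e n r.
Proof.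
apply/mpolyP => m; rewrite mcoeff_comp_last0 !mcoeff_Wpoly.
have -> : mdeg (mnmwiden m) = mdeg m.
  rewrite !mdegE big_ord_recr /= mnmwiden_ordmax addn0.
  by apply: eq_bigr => i _; rewrite mnmwiden_widen.
case: ifP => // _; congr (_ / _%:R).
rewrite big_ord_recr /= mnmwiden_ordmax muln0 fact0 muln1.
by apply: eq_bigr => i _; rewrite mnmwiden_widen.
Qed.

Lemma Wpoly_bounded : exists d, forall r, (msize (Wpoly e n r) <= d)%N.
Proof.
exists n.+1 => r; rewrite msizeE; apply/bigmax_leqP_seq => m m_in _.
by rewrite ltnS (dhomog_mf (Wpoly_homog r) m_in).
Qed.

Definition W : symfun C := SymFun Wpoly_sym Wpoly_stable Wpoly_bounded.

End W.

Arguments W C e n e_gt0 : clear implicits.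

(* Main.v *)
(** With [a_k = 1 / (e k)!], the function W is [(e n)!] times the degree [n]
    part of the product over [i] of [sum_k a_k x_i^k], so by Cauchy and
    Jacobi-Trudi its coefficient on [s_la] is [(e n)! det (a_(la_i - i + j))].
    The expansion is obtained by induction on the number of variables: the
    branching rule for tableaux removes one variable and is matched by the Pieri
    rule for the determinants, which results from row and column operations.
    For positivity, [D b c = det (1 / (b_i - c_j)!)] satisfies
    [(sum b - sum c) D b c = sum_i D (b - e_i) c], hence it is nonnegative for
    strictly monotone [b] and [c] (it counts standard skew tableaux, up to a
    factor).

    A partition with at most [L] rows is encoded by the increasing sequence
    [p_i = la_(L-1-i) + i], [i < L]. *)

Require Import Defs.
From mathcomp Require Import all_boot all_order all_algebra.
From mathcomp Require Import all_fingroup finmap mpoly zify.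

Set Implicit Arguments.
Unset Strict Implicit.
Unset Printing Implicit Defensive.

Import Order.TTheory GRing.Theory Num.Theory.

(** * Strictly increasing sequences *)

Definition strict l (p : 'I_l -> nat) := forall i j : 'I_l, i < j -> p i < p j.

Lemma strict_ge l (p : 'I_l -> nat) (i : 'I_l) : strict p -> i <= p i.
Proof.
move=> p_st; case: i; elim=> [//|k IHk] lt_k.
by apply: leq_ltn_trans (IHk (ltnW lt_k)) _; apply: p_st.
Qed.

Lemma strict_diff l (p : 'I_l -> nat) (i j : 'I_l) : strict p -> i <= j ->
  p i + (j - i) <= p j.
Proof.
move=> p_st; case: j => j; elim: j => [|j IHj] lt_j le_ij.
  by rewrite (_ : i = Ordinal lt_j) ?subnn ?addn0 //; apply/val_inj/eqP; rewrite /= -leqn0.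
rewrite leq_eqVlt in le_ij; case/orP: le_ij => [/eqP E|lt_ij].
  by rewrite (_ : i = Ordinal lt_j) ?subnn ?addn0 //; apply/val_inj.
have /= := IHj (ltnW lt_j) lt_ij.
have := p_st (Ordinal (ltnW lt_j)) (Ordinal lt_j) (ltnSn _).
by move: lt_ij => /=; lia.
Qed.

Lemma strict_sum_ge l (p : 'I_l -> nat) : strict p -> \sum_(i < l) i <= \sum_(i < l) p i.
Proof. by move=> p_st; apply: leq_sum => i _; apply: strict_ge. Qed.

(** If [p ord0] were positive, every [p i] would be at least [i + 1]. For partitions: fewer cells
    than rows leave an empty row. *)
Lemma strict_first0 l (p : 'I_l.+1 -> nat) : strict p ->
  \sum_(i < l.+1) p i < \sum_(i < l.+1) i + l.+1 -> p ord0 = 0.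
Proof.
move=> p_st; apply: contraTeq; rewrite -lt0n -leqNgt => p0.
have -> : \sum_(i < l.+1) i + l.+1 = \sum_(i < l.+1) (i + 1).
  by rewrite big_split /= sum1_card card_ord.
apply: leq_sum => i _.
by have := @strict_diff _ p ord0 i p_st isT; rewrite /=; lia.
Qed.

(** Both hypotheses together make [s] increasing, so [i <= s i] for all [i]; the two sides have the
    same sum, hence agree. *)
Lemma strict_perm_id l (c : 'I_l -> nat) (s : {perm 'I_l}) :
  strict c -> strict (fun i => c (s i)) -> s = 1%g.
Proof.
move=> c_st cs_st.
have s_st (i j : 'I_l) : i < j -> s i < s j.
  move=> lt_ij; have := cs_st _ _ lt_ij.
  case: (ltngtP (s i) (s j)) => // [lt_s|/val_inj->]; last by rewrite ltnn.
  by move=> /(ltn_trans (c_st _ _ lt_s)); rewrite ltnn.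
have ge_s (i : 'I_l) : i <= s i by apply: (strict_ge (p := fun i => s i)).
have sum_s : \sum_i s i = \sum_(i < l) i.
  by rewrite [RHS](reindex_inj (@perm_inj _ s)).
have : \sum_(i < l) (s i - i) == 0.
  by rewrite sumnB // sum_s subnn.
rewrite sum_nat_eq0 => /forallP s_le.
apply/permP => i; rewrite perm1; apply/val_inj/eqP.
by rewrite /= eqn_leq ge_s andbT -subn_eq0; apply: (s_le i).
Qed.

(** * Horizontal strips *)

Section Interlacing.
Variables L P : nat.

(* The value [P] at [k = L] leaves the longest row of a strip bounded only by the box. *)
Definition ext (q : 'I_L -> 'I_P) (k : nat) : nat := oapp (fun i => q i : nat) P (insub k).

(** For the row lengths [p i - i] and [q i - i], listed from the shortest, this says that the skew
    shape [p / q] is a horizontal strip. *)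
Definition interlaces (q p : 'I_L -> 'I_P) : bool :=
  [forall i, q i <= p i < ext q i.+1].

Lemma ext_ord q (i : 'I_L) : ext q i = q i.
Proof. by rewrite /ext valK. Qed.

Lemma ext_out q : ext q L = P.
Proof. by rewrite /ext insubF // ltnn. Qed.

End Interlacing.

(** * Tableaux in a box and the branching rule *)

Section BoxTableaux.
Variables (L P R : nat).
Implicit Types (p q : {ffun 'I_L -> 'I_P}) (x y : 'I_L * 'I_P).
Implicit Types (T : {ffun 'I_L * 'I_P -> 'I_R}) (r : nat) (m : nat -> nat).

Definition strictb p : bool := [forall i : 'I_L, forall j : 'I_L, (i < j) ==> (p i < p j)].

Lemma strictP p : reflect (strict (fun i => p i)) (strictb p).
Proof.
apply: (iffP forallP) => [p_st i j|p_st i]; first by move/forallP/(_ j)/implyP: (p_st i).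
by apply/forallP => j; apply/implyP/p_st.
Qed.

Definition inside p x : bool := x.2 + x.1 < p x.1.

(* A semistandard tableau with entries below [r], extended to the whole box by
   the value [r]; row [i] has length [p i - i], so rows are listed from the
   shortest to the longest and columns decrease strictly. *)
Definition boxtab p r T : bool :=
  [forall x : 'I_L * 'I_P, (T x <= r) && ((T x < r) == inside p x)] &&
  [forall x : 'I_L * 'I_P, forall y : 'I_L * 'I_P,
    ((x.1 == y.1) && (x.2 < y.2) ==> (T x <= T y)) &&
    ((x.2 == y.2) && (x.1 < y.1) && inside p x ==> (T y < T x))].

Definition content r m T : bool :=
  [forall i : 'I_R, (i < r) ==> (#|[set x | T x == i]| == m i)].

Definition kostka p r m : nat := #|[set T | boxtab p r T && content r m T]|.

Lemma boxtabP p r T :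
  reflect [/\ forall x, T x <= r, forall x, (T x < r) = inside p x,
              forall x y, x.1 = y.1 -> x.2 < y.2 -> T x <= T y &
              forall x y, x.2 = y.2 -> x.1 < y.1 -> inside p x -> T y < T x]
          (boxtab p r T).
Proof.
apply: (iffP andP) => [[/forallP H1 /forallP H2]|[H1 H2 H3 H4]].
  split=> [x|x|x y E lt|x y E lt ins].
  - by case/andP: (H1 x).
  - by case/andP: (H1 x) => _ /eqP.
  - by move/forallP/(_ y)/andP: (H2 x) => [/implyP + _]; rewrite E lt eqxx; apply.
  - by move/forallP/(_ y)/andP: (H2 x) => [_ /implyP]; rewrite E lt eqxx ins; apply.
split; apply/forallP => x; first by rewrite H1 H2 eqxx.
apply/forallP => y; apply/andP; split; apply/implyP.
  by case/andP => /eqP; apply: H3.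
by case/andP => /andP[/eqP]; apply: H4.
Qed.

Lemma card_inside p : strict (fun i => p i) ->
  #|[set x | inside p x]| = \sum_(i < L) p i - \sum_(i < L) i.
Proof.
move=> p_st; rewrite -sumnB => [|i _]; last exact: (strict_ge i p_st).
rewrite -sum1dep_card.
rewrite (eq_bigl (fun x => true && (x.2 + x.1 < p x.1))) //.
rewrite -(pair_big_dep xpredT (fun (i : 'I_L) (j : 'I_P) => j + i < p i) (fun _ _ => 1)) /=.
apply: eq_bigr => i _.
have le_P : p i - i <= P by apply: leq_trans (leq_subr _ _) (ltnW (ltn_ord _)).
rewrite (eq_bigl (fun j : 'I_P => j < p i - i)) => [|j]; last by rewrite ltn_subRL addnC.
by rewrite (big_ord_narrow le_P) sum1_card card_ord.
Qed.

Lemma ext_succ_lt q (i : 'I_L) b : (forall j : 'I_L, j = i.+1 :> nat -> b < q j) -> b < P ->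
  b < ext q i.+1.
Proof.
move=> lt_bq lt_bP; have [lt_iL|ge_iL] := ltnP i.+1 L.
  by rewrite -[i.+1]/(nat_of_ord (Ordinal lt_iL)) ext_ord; apply: lt_bq.
by rewrite /ext insubF //= ltnNge ge_iL.
Qed.

Lemma interlacesP q p : reflect
  (forall i, q i <= p i /\ forall j : 'I_L, j = i.+1 :> nat -> p i < q j) (interlaces q p).
Proof.
apply: (iffP forallP) => qp i; last first.
  by have [-> lt_pq] := qp i; apply: ext_succ_lt.
by case/andP: (qp i) => -> lt_pq; split=> // j j_i; rewrite -j_i ext_ord in lt_pq.
Qed.

Lemma interlaces_strictl q p : strict (fun i => p i) -> interlaces q p ->
  strict (fun i => q i).
Proof.
move=> p_st /interlacesP qp i [[//|j] lt_j] lt_ij.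
have [le_qp _] := qp i; have [_ /(_ (Ordinal lt_j) erefl)] := qp (Ordinal (ltnW lt_j)).
by have /= := strict_diff (j := Ordinal (ltnW lt_j)) p_st lt_ij; move: lt_ij; lia.
Qed.

Lemma interlaces_strictr q p : strict (fun i => q i) -> interlaces q p ->
  strict (fun i => p i).
Proof.
move=> q_st /interlacesP qp i j lt_ij.
have [le_qp _] := qp j; have lt_i1 : i.+1 < L by apply: leq_ltn_trans lt_ij _.
have [_ /(_ (Ordinal lt_i1) erefl)] := qp i.
by have /= := strict_diff (i := Ordinal lt_i1) q_st lt_ij; lia.
Qed.

Lemma inside_inj p q : strict (fun i => p i) -> strict (fun i => q i) ->
  inside p =1 inside q -> p = q.
Proof.
move=> p_st q_st pq; apply/ffunP => i; apply/val_inj => /=.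
wlog lt_pq : p q p_st q_st pq / p i < q i.
  by move=> th; case: (ltngtP (p i) (q i)) => // /th E; [apply: E|apply/esym/E].
have le_ip := strict_ge i p_st.
(* The cell in column [p i - i] of row [i] belongs to [q] but not to [p]. *)
have lt_P : p i - i < P by apply: leq_ltn_trans (leq_subr _ _) _.
have := pq (i, Ordinal lt_P); rewrite /inside /= subnK // ltnn.
by rewrite lt_pq.
Qed.

Lemma card_ord_lt b : b <= P -> #|[set j : 'I_P | j < b]| = b.
Proof.
move=> le_bP; rewrite -sum1dep_card (big_ord_narrow le_bP).
by rewrite sum1_card card_ord.
Qed.

Lemma down_closed_card (A : {set 'I_P}) :
  (forall i j : 'I_P, i < j -> j \in A -> i \in A) ->
  forall j : 'I_P, (j \in A) = (j < #|A|).
Proof.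
move=> A_down j; apply/idP/idP => [j_A|].
  rewrite -(card_ord_lt (ltn_ord j)) subset_leq_card //.
  apply/subsetP => i; rewrite inE ltnS leq_eqVlt => /orP[/eqP/val_inj->//|lt_ij].
  exact: A_down j_A.
apply: contraTT => j_A; rewrite -leqNgt -(card_ord_lt (ltnW (ltn_ord j))).
apply/subset_leq_card/subsetP => i i_A; rewrite inE ltnNge leq_eqVlt.
apply: contra j_A => /orP[/eqP/val_inj->//|lt_ji]; exact: A_down i_A.
Qed.

(** The shape occupied by the entries below [r]. For a tableau of strict shape [p] the value stays
    at most [p i] by [cutE], so [insubd] never falls back on its default. *)
Definition cut p r T : {ffun 'I_L -> 'I_P} :=
  [ffun i => insubd (p i) (#|[set j | T (i, j) < r]| + i)].

Lemma cutE p r T (i : 'I_L) : strict (fun i => p i) -> boxtab p r.+1 T ->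
  cut p r T i = #|[set j | T (i, j) < r]| + i :> nat /\ cut p r T i <= p i.
Proof.
move=> p_st /boxtabP[_ Tp _ _]; have le_ip := strict_ge i p_st.
have le_p : #|[set j | T (i, j) < r]| + i <= p i.
  rewrite addnC -leq_subRL // -[leqRHS]card_ord_lt; last first.
    by apply: leq_trans (leq_subr _ _) (ltnW (ltn_ord _)).
  apply/subset_leq_card/subsetP => j; rewrite !inE => /ltnW.
  by rewrite -ltnS Tp /inside /= ltn_subRL addnC.
by rewrite ffunE val_insubd (leq_ltn_trans le_p).
Qed.

Lemma inside_cut p r T x : strict (fun i => p i) -> boxtab p r.+1 T ->
  inside (cut p r T) x = (T x < r).
Proof.
case: x => i j p_st bT; rewrite /inside (proj1 (cutE i p_st bT)) ltn_add2r.
rewrite -down_closed_card ?inE //= => {}j k lt_jk; rewrite !inE.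
by apply: leq_ltn_trans; case/boxtabP: bT => _ _ T_row _; apply: T_row.
Qed.

Lemma interlaces_cut p r T : strict (fun i => p i) -> boxtab p r.+1 T ->
  interlaces (cut p r T) p.
Proof.
move=> p_st bT; apply/interlacesP => i; split; first by case: (cutE i p_st bT).
move=> k k_i; have [_ Tp _ T_col] := boxtabP _ _ _ bT.
rewrite ltnNge; apply/negP => le_cp; have [cE _] := cutE k p_st bT.
(* In row [k], the cell in column [j] below is the first whose value is not below [r]. The cell
   [(i, j)] holds at most [r], so the strict decrease in the column gives a contradiction. *)
have lt_P : cut p r T k - k < P by apply: leq_ltn_trans (leq_subr _ _) _.
pose j := Ordinal lt_P.
have ins : inside p (i, j) by rewrite /inside /=; lia.
have := T_col (i, j) (k, j) erefl; rewrite /= k_i ltnSn => /(_ isT ins) lt_T.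
have : T (k, j) < r by apply: leq_trans lt_T _; rewrite -ltnS Tp.
by rewrite -(inside_cut _ p_st bT) /inside /=; lia.
Qed.

Lemma card_entries p q r T : strict (fun i => p i) -> strict (fun i => q i) ->
  boxtab p r.+1 T -> (forall x, (T x < r) = inside q x) ->
  #|[set x | T x == r :> nat]| + \sum_(i < L) q i = \sum_(i < L) p i.
Proof.
move=> p_st q_st /boxtabP[_ Tp _ _] Tq.
have := cardsID [set x | T x < r] [set x | T x < r.+1].
rewrite (_ : _ :&: _ = [set x | inside q x]); last first.
  by apply/setP => x; rewrite !inE -Tq; apply: andb_idl; exact: ltnW.
rewrite (_ : _ :\: _ = [set x | T x == r :> nat]); last first.
  by apply/setP => x; rewrite !inE ltnS -leqNgt andbC -eqn_leq.
rewrite (_ : [set x | T x < r.+1] = [set x | inside p x]); last first.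
  by apply/setP => x; rewrite !inE Tp.
rewrite !card_inside //.
have := strict_sum_ge p_st; have := strict_sum_ge q_st => /=; lia.
Qed.

(** * The bijection behind the branching rule *)

Section Branch.
Variables (r : nat) (lt_rR : r.+1 < R) (m : nat -> nat) (p q : {ffun 'I_L -> 'I_P}).
Hypotheses (p_st : strict (fun i => p i)) (q_st : strict (fun i => q i)).
Hypothesis qp : interlaces q p.
Hypothesis sum_pq : \sum_(i < L) p i = \sum_(i < L) q i + m r.

(** [lower] turns everything outside [q] into the filler [r]; its inverse [raise] puts [r] on the
    strip [p / q] and the filler [r.+1] outside [p]. *)
Let lower T : {ffun 'I_L * 'I_P -> 'I_R} :=
  [ffun x => if T x < r then T x else Ordinal (ltnW lt_rR)].

Let raise T : {ffun 'I_L * 'I_P -> 'I_R} :=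
  [ffun x => if inside q x then T x else
             if inside p x then Ordinal (ltnW lt_rR) else Ordinal lt_rR].

Let fiber := [set T | [&& boxtab p r.+1 T, content r.+1 m T & cut p r T == q]].

Lemma inside_interlaces x : inside q x -> inside p x.
Proof.
move/interlacesP: qp => /(_ x.1) [le_qp _]; rewrite /inside => lt_q; exact: leq_trans lt_q le_qp.
Qed.

Lemma fiberP T : T \in fiber ->
  [/\ boxtab p r.+1 T, content r.+1 m T & forall x, (T x < r) = inside q x].
Proof.
rewrite inE => /and3P[bT cT /eqP cut_q]; split=> // x.
by rewrite -cut_q inside_cut.
Qed.

Lemma lower_inj : {in fiber &, injective lower}.
Proof.
move=> T T' /fiberP[/boxtabP[T_le Tp _ _] _ Tq] /fiberP[/boxtabP[T_le' Tp' _ _] _ Tq'] /ffunP E.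
apply/ffunP => x; apply/val_inj => /=; have := E x; rewrite !ffunE Tq Tq'.
have := T_le x; have := T_le' x; have := Tp x; have := Tp' x; have := Tq x; have := Tq' x.
case: (inside q x) => [_ _ _ _ _ _ ->//|].
by case: (inside p x); lia.
Qed.

Lemma content_lower T : boxtab p r.+1 T -> (forall x, (T x < r) = inside q x) ->
  content r.+1 m T = content r m (lower T).
Proof.
move=> bT Tq; have cE (i : 'I_R) : i < r ->
    #|[set x | T x == i]| = #|[set x | lower T x == i]|.
  move=> lt_ir; apply: eq_card => x; rewrite !inE ffunE -!val_eqE /=.
  by case: (ltnP (T x) r) => //= le_rT; rewrite !gtn_eqF //; apply: leq_trans le_rT.
apply/forallP/forallP => cT i; apply/implyP => lt_ir.
  by rewrite -cE //; apply: (implyP (cT i)); apply: ltnW.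
rewrite ltnS leq_eqVlt in lt_ir; case/orP: lt_ir => [/eqP i_r|lt_ir]; last first.
  by rewrite cE //; apply: (implyP (cT i)).
(* The multiplicity of the value [r] is the size of the strip, which [sum_pq] fixes. *)
rewrite i_r; have := card_entries p_st q_st bT Tq; rewrite sum_pq addnC => /eqP.
rewrite eqn_add2l => /eqP <-; apply/eqP/eq_card => x.
by rewrite !inE -val_eqE /= i_r.
Qed.

Lemma lower_boxtab T : boxtab p r.+1 T -> (forall x, (T x < r) = inside q x) ->
  boxtab q r (lower T).
Proof.
move=> /boxtabP[T_le Tp T_row T_col] Tq; apply/boxtabP; split=> [x|x|x y E lt|x y E lt ins];
  rewrite !ffunE.
- by case: ltnP => //= /ltnW.
- by rewrite -Tq; case: (ltnP (T x) r) => //=; rewrite ltnn.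
- by have := T_row _ _ E lt; do 2![case: ifP => //=]; lia.
have := T_col _ _ E lt (inside_interlaces ins); rewrite -Tq in ins; rewrite ins => lt_T.
by rewrite (ltn_trans lt_T ins).
Qed.

Lemma raise_boxtab T : boxtab q r T -> boxtab p r.+1 (raise T).
Proof.
move=> /boxtabP[T_le Tq T_row T_col]; have /interlacesP qpP := qp.
apply/boxtabP; split=> [x|x|x y E lt|x y E lt ins]; rewrite !ffunE.
- by case: ifP => _; [apply: leqW|case: ifP].
- have := @inside_interlaces x; case: ifP => [ins /(_ isT) ->|_ _].
    by apply: leqW; rewrite Tq.
  by case: ifP => _ /=; rewrite ?ltnSn ?ltnn.
- have := T_row _ _ E lt; have := T_le x.
  have := Tq x; have := Tq y; have := T_le y; rewrite /inside E.
  by do ?[case: ifP => /= ?]; lia.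
have := T_col _ _ E lt; have := Tq x; have := Tq y; rewrite ins.
(* A horizontal strip has at most one cell in a column: since [p] at row [x.1] is below [q] at the
   next row, the cell [y] of a longer row is already in [q]. *)
have -> : inside q y.
  move: ins; rewrite /inside; have lt_i1 : x.1.+1 < L by apply: leq_ltn_trans lt _.
  have [_ /(_ (Ordinal lt_i1) erefl)] := qpP x.1.
  by have /= := strict_diff (i := Ordinal lt_i1) q_st lt; rewrite E; move: lt; lia.
by case: (inside q x) => [_ _ ->|/= -> _ _].
Qed.

Lemma raiseK T : boxtab q r T -> lower (raise T) = T.
Proof.
move=> /boxtabP[T_le Tq _ _]; apply/ffunP => x; apply/val_inj; rewrite !ffunE -Tq /=.
case: (ltnP (T x) r) => [->//|ge_T].
have -> : T x = r :> nat by apply/eqP; rewrite eqn_leq T_le.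
by case: (inside p x) => /=; rewrite ?ltnn // ltnNge leqnSn.
Qed.

Lemma card_fiber : #|fiber| = kostka q r m.
Proof.
rewrite -(card_in_imset lower_inj); apply: eq_card => T; rewrite !inE.
apply/imsetP/andP => [[T' /fiberP[bT cT Tq] ->]|[bT cT]].
  by rewrite lower_boxtab // -content_lower.
have bT' := raise_boxtab bT.
have Tq' x : (raise T x < r) = inside q x.
  rewrite ffunE; have /boxtabP[_ Tq _ _] := bT; rewrite -Tq.
  by case: (ltnP (T x) r) => [->//|]; case: ifP => /=; rewrite ?ltnn // ltnNge leqnSn.
exists (raise T); last by rewrite raiseK.
rewrite inE bT' (content_lower bT' Tq') raiseK // cT /=; apply/eqP/inside_inj => //.
  by apply: interlaces_strictl (interlaces_cut p_st bT').
by move=> x; rewrite inside_cut.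
Qed.

End Branch.

(** Tableaux are sorted by the shape of their entries below [r]; the entries [r] fill a horizontal
    strip of [m r] cells. The bound on [R] leaves room for the filler [r.+1]. *)
Lemma kostka_branch r m p : r.+1 < R -> strict (fun i => p i) ->
  kostka p r.+1 m =
  \sum_(q : {ffun 'I_L -> 'I_P} | interlaces q p && (\sum_(i < L) p i == \sum_(i < L) q i + m r))
    kostka q r m.
Proof.
move=> lt_rR p_st; rewrite /kostka -sum1_card.
rewrite (partition_big (cut p r)
  (fun q => interlaces q p && (\sum_(i < L) p i == \sum_(i < L) q i + m r))) /=; last first.
  move=> T; rewrite inE => /andP[bT /forallP cT].
  have qp := interlaces_cut p_st bT; rewrite qp /=.
  have q_st := interlaces_strictl p_st qp.
  rewrite -(card_entries (q := cut p r T) p_st q_st bT) 1?addnC; last first.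
    by move=> x; rewrite inside_cut.
  rewrite eqn_add2l; have /implyP/(_ (ltnSn r)) := cT (Ordinal (ltnW lt_rR)).
  by congr (_ == _); apply: eq_card => x; rewrite !inE -val_eqE.
apply: eq_bigr => q /andP[qp /eqP sum_pq].
rewrite -/(kostka q r m) -(card_fiber lt_rR p_st (interlaces_strictl p_st qp) qp sum_pq).
rewrite -sum1_card; apply: eq_bigl => T; rewrite !inE.
by rewrite andbA.
Qed.

End BoxTableaux.

Local Open Scope ring_scope.

(** * Positivity *)

(** The value of [a] at the integer [p - j], with zero at negative indices; truncated subtraction
    alone would give [a 0] there. *)
Definition shifted (R : nzRingType) (a : nat -> R) (p j : nat) : R :=
  if (j <= p)%N then a (p - j)%N else 0.

Section InvFact.
Variable R : numFieldType.

Definition invfact (k : nat) : R := (k`!)%:R^-1.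

Definition fact_mx l (b c : 'I_l -> nat) : 'M[R]_l :=
  \matrix_(i, j) shifted invfact (b i) (c j).

(** At [b = c] the factor vanishes, and on the right the index is negative. Positivity of [b] makes
    [b.-1] a true predecessor. *)
Lemma shifted_invfact_pred b c : (0 < b)%N ->
  (b%:R - c%:R) * shifted invfact b c = shifted invfact b.-1 c.
Proof.
case: b => // b _; rewrite /shifted /invfact /=.
case: (ltngtP c b.+1) => [lt_cb|lt_bc|->].
- rewrite -ltnS lt_cb subSn // factS natrM invfM -natrB 1?ltnW //.
  rewrite subSn // mulrA mulfV ?mul1r // pnatr_eq0 //.
- by rewrite mulr0 leqNgt (ltnW lt_bc).
- by rewrite subrr mul0r ltnn.
Qed.

(* Multiplying the Leibniz term of [s] by sum_i (b_i - c_(s i)), which does not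
   depend on [s], amounts to lowering the b_i one at a time. *)
Lemma det_fact_mx_lower l (b c : 'I_l -> nat) :
  ((\sum_i b i)%N%:R - (\sum_i c i)%N%:R) * \det (fact_mx b c) =
  \sum_i \det (\matrix_(k, j)
    ((if k == i then (b k)%:R - (c j)%:R else 1) * fact_mx b c k j)).
Proof.
rewrite /determinant exchange_big mulr_sumr /=; apply: eq_bigr => s _.
have -> : (\sum_i c i = \sum_i c (s i))%N by rewrite [LHS](reindex_inj (@perm_inj _ s)).
rewrite !natr_sum -sumrB mulrCA -mulr_sumr; congr (_ * _).
rewrite mulr_suml; apply: eq_bigr => i _.
rewrite [in RHS](bigD1 i) //= (bigD1 i) //= !mxE eqxx mulrA; congr (_ * _).
by apply: eq_bigr => k /negbTE k_i; rewrite mxE k_i mul1r.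
Qed.

Lemma det_fact_mx_ge0 l (b c : 'I_l -> nat) :
  strict b -> strict c -> 0 <= \det (fact_mx b c).
Proof.
move=> + c_st; have [N] := ubnP (\sum_i b i)%N.
elim: N b => // N IHN b; rewrite ltnS => le_bN b_st.
have term0 (s : {perm 'I_l}) i : (b i < c (s i))%N ->
    \prod_i fact_mx b c i (s i) = 0.
  by move=> lt_bc; rewrite (bigD1 i) //= mxE /shifted leqNgt lt_bc mul0r.
have sum_c (s : {perm 'I_l}) : (\sum_i c i = \sum_i c (s i))%N.
  by rewrite [LHS](reindex_inj (@perm_inj _ s)).
have [gt_bc|le_bc] := ltnP (\sum_i c i)%N (\sum_i b i)%N; last first.
  (* A nonzero term of [s] needs [c (s i) <= b i] for all [i]; as the sum of [b] does not exceed
     that of [c], these are equalities, and strictness forces [s] to be the identity. *)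
  rewrite /determinant (bigD1 1%g) //= [X in _ + X]big1 ?addr0 => [|s s_neq1].
    rewrite odd_perm1 mul1r. apply: prodr_ge0 => i _.
    by rewrite mxE /shifted /invfact; case: ifP => // _; rewrite invr_ge0.
  have [/existsP[i lt_bc]|] := boolP [exists i, (b i < c (s i))%N].
    by rewrite (term0 s i) ?mulr0.
  rewrite negb_exists => /forallP ge_bc; case/eqP: s_neq1.
  have {}ge_bc i : (c (s i) <= b i)%N by rewrite leqNgt.
  have eq_bc i : b i = c (s i).
    apply/eqP; rewrite eqn_leq ge_bc andbT -subn_eq0.
    have : (\sum_i (b i - c (s i)) == 0)%N.
      by rewrite sumnB // -sum_c subn_eq0.
    by rewrite sum_nat_eq0 => /forallP /(_ i).
  by apply: (strict_perm_id c_st) => i j; rewrite -!eq_bc; apply: b_st.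
have pos : 0 < (\sum_i b i)%N%:R - (\sum_i c i)%N%:R :> R.
  by rewrite subr_gt0 ltr_nat.
rewrite -(pmulr_rge0 _ pos) det_fact_mx_lower sumr_ge0 // => i _.
have [bi0|bi_gt0] := posnP (b i).
  (* The row [i] is zero: the factor vanishes where [c j = 0], and the entry of [fact_mx] vanishes
     elsewhere. *)
  rewrite (expand_det_row _ i) big1 // => j _.
  rewrite !mxE eqxx bi0 /shifted leqn0 sub0r.
  by case: eqP => [->|]; rewrite ?oppr0 ?mulr0 ?mul0r.
pose b' k := if k == i then (b k).-1 else b k.
set A := (X in \det X); have -> : A = fact_mx b' c.
  apply/matrixP => k j; rewrite !mxE /b'.
  by case: (eqVneq k i) => [->|]; rewrite ?mul1r ?shifted_invfact_pred.
(* Lowering [b i] by one either makes two rows equal or keeps the sequence strict, where the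
   induction hypothesis applies. *)
have [/existsP[k /andP[k_i /eqP eq_b]]|] := boolP [exists k, (k != i) && (b' k == b' i)].
  rewrite (determinant_alternate k_i) // => j.
  by rewrite !mxE eq_b.
rewrite negb_exists => /forallP b'_neq; apply: IHN.
  apply: leq_trans le_bN; rewrite [ltnRHS](bigD1 i) //= (bigD1 i) //= /b' eqxx.
  rewrite -ltnS -addSn prednK //= ltnS leq_add2l.
  by apply: leq_sum => k /negbTE ->.
move=> k j lt_kj; have := b_st _ _ lt_kj; have := b'_neq k; rewrite /b'.
have [->|/negbTE k_i] := eqVneq k i; have [->|/negbTE j_i] := eqVneq j i;
  rewrite ?eqxx ?k_i ?j_i /=; lia.
Qed.

End InvFact.

(** * The Pieri rule for Jacobi-Trudi determinants *)

Section DetSum.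
Variable R : comNzRingType.

Lemma det_row_sum l (J : finType) (Q : 'I_l -> pred J) (F : 'I_l -> J -> 'I_l -> R) :
  \det (\matrix_(i, j) \sum_(x | Q i x) F i x j) =
  \sum_(p in family Q) \det (\matrix_(i, j) F i (p i) j).
Proof.
rewrite /determinant exchange_big /=; apply: eq_bigr => s _.
under eq_bigr do rewrite mxE.
rewrite (bigA_distr_big_dep Q (fun i x => F i x (s i))) mulr_sumr /=.
apply: eq_bigr => p _; congr (_ * _).
by apply: eq_bigr => i _; rewrite mxE.
Qed.

Lemma det_row_monomial l (b : 'I_l -> nat) (A : 'M[R]_l) :
  \det (\matrix_(i, j) (A i j *: 'X^(b i))) = \det A *: 'X^(\sum_i b i).
Proof.
rewrite /determinant scaler_suml; apply: eq_bigr => s _.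
under eq_bigr do rewrite mxE.
by rewrite scaler_prod prodrXr !mulr_sign; case: (odd_perm s); rewrite /= ?scaleNr.
Qed.

End DetSum.

Section Pieri.
Variables (R : comNzRingType) (a : nat -> R) (l P : nat).
Local Notation L := l.+1.
Hypothesis a0 : a 0%N = 1.
Hypothesis a_large : forall k, (P < k + L)%N -> a k = 0.

(** Reversing rows and columns gives the usual Jacobi-Trudi determinant [det (a_(la_i - i + j))]. *)
Definition jt_det (p : 'I_L -> nat) : R := \det (\matrix_(i, j) shifted a (p i) j).

Variable q : {ffun 'I_L -> 'I_P}.
Hypothesis q_strict : strict (fun i => q i).
Hypothesis q0 : q ord0 = 0%N :> nat.

(* [strip_mx] arises from [tail_mx] by subtracting from each row the next one,
   and [reduced_mx] by subtracting from each column ['X] times the previous one. *)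
Let strip_mx : 'M[{poly R}]_L :=
  \matrix_(i, j) \sum_(x : 'I_P | (q i <= x < ext q i.+1)%N) shifted a x j *: 'X^x.
Let tail (b j : nat) : {poly R} := \sum_(x : 'I_P | (b <= x)%N) shifted a x j *: 'X^x.
Let tail_mx : 'M[{poly R}]_L := \matrix_(i, j) tail (q i) j.
Let reduced_mx : 'M[{poly R}]_L :=
  \matrix_(i, j) if j == ord0 then tail (q i) 0 else shifted a (q i) j *: 'X^(q i).

(** Interlacing bounds each [p i] separately, so multilinearity in the rows enumerates exactly the
    strips over [q], while ['X] records the total. *)
Lemma det_strip_mx :
  \det strip_mx =
  \sum_(p : {ffun 'I_L -> 'I_P} | interlaces q p) jt_det (fun i => p i) *: 'X^(\sum_(i < L) p i).
Proof.
rewrite det_row_sum; apply: eq_big => [p|p _]; first by rewrite unfold_in.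
rewrite -det_row_monomial; congr (\det _).
by apply/matrixP => i j; rewrite !mxE.
Qed.

Lemma det_strip_tail : \det strip_mx = \det tail_mx.
Proof.
pose U : 'M[{poly R}]_L := \matrix_(i, k) ((i == k)%:R - (i.+1 == k)%:R).
have -> : strip_mx = U *m tail_mx.
  apply/matrixP => i j; rewrite !mxE.
  under [RHS]eq_bigr => k _ do rewrite !mxE mulrBl.
  rewrite sumrB.
  have -> : \sum_(k < L) (i == k)%:R * tail (q k) j = tail (q i) j.
    rewrite (bigD1 i) //= eqxx mul1r big1 ?addr0 // => k /negbTE.
    by rewrite eq_sym => ->; rewrite mul0r.
  have -> : \sum_(k < L) (i.+1 == k)%:R * tail (q k) j = tail (ext q i.+1) j.
    have [lt_iL|ge_iL] := ltnP i.+1 L.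
      rewrite (bigD1 (Ordinal lt_iL)) //= eqxx mul1r big1 ?addr0.
        by rewrite -ext_ord.
      move=> k; rewrite -val_eqE /= eq_sym => /negbTE ->; exact: mul0r.
    (* Nothing is subtracted from the last row: the tail starting at [P] is empty. *)
    have {ge_iL} iL : i.+1 = L by apply/eqP; rewrite eqn_leq ge_iL ltn_ord.
    rewrite iL ext_out big1 => [|k _]; last by rewrite gtn_eqF ?mul0r.
    by rewrite /tail big1 // => x; rewrite leqNgt ltn_ord.
  have q_le : (q i <= ext q i.+1)%N.
    have [lt_iL|ge_iL] := ltnP i.+1 L; last first.
      by rewrite /ext insubF /= ?(ltnW (ltn_ord _)) // ltnNge ge_iL.
    by rewrite -[i.+1]/(nat_of_ord (Ordinal lt_iL)) ext_ord ltnW //; apply: q_strict.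
  rewrite /tail [X in _ = X - _](bigID (fun x : 'I_P => (x < ext q i.+1)%N)) /=.
  rewrite -addrA [X in _ = _ + (X - _)](eq_bigl (fun x : 'I_P => (ext q i.+1 <= x)%N)).
    by rewrite subrr addr0.
  by move=> x /=; rewrite -leqNgt; apply: andb_idl => /(leq_trans q_le).
rewrite det_mulmx -det_tr det_trig ?big1 ?mul1r // => [i _|].
  by rewrite !mxE eqxx gtn_eqF // subr0.
apply/is_trig_mxP => i j lt_ij; rewrite !mxE -val_eqE /= !gtn_eqF ?subrr //.
by rewrite ltnS ltnW.
Qed.

Let tailE b j : tail b j = \sum_(b <= x < P) shifted a x j *: 'X^x.
Proof. by rewrite (big_nat_widenl b 0) // big_mkord. Qed.

Lemma tail_succ (b j : nat) : (b < P)%N -> (j.+1 < L)%N ->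
  tail b j.+1 - 'X * tail b j = shifted a b j.+1 *: 'X^b.
Proof.
move=> lt_bP lt_jL; rewrite !tailE mulr_sumr.
under [X in _ - X]eq_bigr => x _.
  rewrite -scalerAr -exprS (_ : shifted a x j = shifted a x.+1 j.+1) //. over.
rewrite -(big_add1 _ _ b P.+1 xpredT (fun x => shifted a x j.+1 *: 'X^x)) /=.
rewrite [X in _ - X]big_nat_recr //= {3}/shifted.
(* The boundary term [x = P] has index [P - j.+1], which is beyond [P - L]. *)
rewrite a_large; last by move: lt_jL; lia.
by rewrite if_same scale0r addr0 [X in X - _]big_ltn // addrK.
Qed.

Lemma det_tail_reduced : \det tail_mx = \det reduced_mx.
Proof.
pose V : 'M[{poly R}]_L := \matrix_(k, j) ((k == j)%:R - (k.+1 == j)%:R * 'X).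
have -> : reduced_mx = tail_mx *m V.
  apply/matrixP => i j; rewrite !mxE.
  under [RHS]eq_bigr => k _ do rewrite !mxE mulrBr.
  rewrite sumrB.
  have -> : \sum_(k < L) tail (q i) k * (k == j)%:R = tail (q i) j.
    by rewrite (bigD1 j) //= eqxx mulr1 big1 ?addr0 // => k /negbTE ->; rewrite mulr0.
  case: j => -[|j] lt_jL; rewrite -val_eqE /=.
    by rewrite big1 ?subr0 // => k _; rewrite mul0r mulr0.
  rewrite -tail_succ //; congr (_ - _).
  rewrite (bigD1 (Ordinal (ltnW lt_jL))) //= eqxx mul1r mulrC big1 ?addr0 // => k.
  by rewrite -val_eqE /= eqSS => /negbTE ->; rewrite mul0r mulr0.
rewrite det_mulmx -[\det V]det_tr [\det V^T]det_trig ?big1 ?mulr1 // => [i _|].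
  by rewrite !mxE eqxx gtn_eqF // mul0r subr0.
apply/is_trig_mxP => i j lt_ij; rewrite !mxE -val_eqE /= !gtn_eqF ?mul0r ?subrr //.
by rewrite ltnS ltnW.
Qed.

(** As [q ord0 = 0], row 0 is zero outside column 0. Expanding [reduced_mx] and [Q] along it gives
    the same cofactor, with corner entries the generating polynomial of [a] and [a 0 = 1]. *)
Lemma det_reduced :
  \det reduced_mx = (\sum_(x < P) a x *: 'X^x) * (jt_det (fun i => q i) *: 'X^(\sum_(i < L) q i)).
Proof.
pose Q : 'M[{poly R}]_L := \matrix_(i, j) (shifted a (q i) j *: 'X^(q i)).
have -> : jt_det (fun i => q i) *: 'X^(\sum_(i < L) q i) = \det Q.
  rewrite -det_row_monomial; congr (\det _).
  by apply/matrixP => i j; rewrite !mxE.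
have det_row0 (A : 'M[{poly R}]_L) : (forall j, j != ord0 -> A ord0 j = 0) ->
    \det A = A ord0 ord0 * cofactor A ord0 ord0.
  move=> A0; rewrite (expand_det_row A ord0) (bigD1 ord0) //= big1 ?addr0 // => j j0.
  by rewrite A0 ?mul0r.
rewrite !det_row0.
- rewrite !mxE eqxx q0 /shifted /= a0 expr0 scale1r mul1r /tail.
  congr (_ * _).
    by apply: eq_bigr => x _; rewrite /shifted /= subn0.
  rewrite /cofactor; congr (_ * \det _).
  by apply/matrixP => i j; rewrite !mxE.
- by move=> [[|j] lt_jL] // _; rewrite !mxE q0 /= scale0r.
by move=> [[|j] lt_jL] // _; rewrite !mxE q0 /= scale0r.
Qed.

(** Compare the coefficients of ['X^(sum q + k)] in the two evaluations of [\det strip_mx]. *)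
Lemma jt_det_pieri (k : nat) : (k < P)%N ->
  \sum_(p : {ffun 'I_L -> 'I_P} | interlaces q p && (\sum_(i < L) p i == \sum_(i < L) q i + k)%N)
    jt_det (fun i => p i) = a k * jt_det (fun i => q i).
Proof.
move=> lt_kP.
have := det_strip_mx; rewrite det_strip_tail det_tail_reduced det_reduced.
move=> /(congr1 (fun f : {poly R} => f`_(\sum_(i < L) q i + k))).
rewrite coef_sum -scalerAr coefZ coefMXn ltnNge leq_addr /= addKn.
rewrite -(poly_def P a) coef_poly lt_kP mulrC => ->.
rewrite [LHS]big_mkcondr; apply: eq_bigr => p _.
by rewrite coefZ coefXn eq_sym; case: eqP; rewrite ?mulr1 ?mulr0.
Qed.

End Pieri.

(** * The Cauchy identity, coefficient by coefficient *)

Section KostkaSum.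
Variables (C : comNzRingType) (a : nat -> C) (l P R : nat).
Local Notation L := l.+1.
Hypothesis a0 : a 0%N = 1.
Hypothesis a_large : forall k, (P < k + L)%N -> a k = 0.
Hypothesis le_LP : (L <= P)%N.
Implicit Types (p q : {ffun 'I_L -> 'I_P}) (m : nat -> nat).

(** The encoding of the empty partition. *)
Definition staircase : {ffun 'I_L -> 'I_P} := [ffun i => widen_ord le_LP i].

Lemma staircase_strict : strict (fun i => staircase i).
Proof. by move=> i j; rewrite !ffunE. Qed.

Lemma jt_det_staircase : jt_det a (fun i => staircase i) = 1.
Proof.
rewrite /jt_det det_trig ?big1 // => [i _|].
  by rewrite mxE ffunE /shifted leqnn subnn.
by apply/is_trig_mxP => i j lt_ij; rewrite mxE ffunE /shifted leqNgt lt_ij.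
Qed.

Lemma kostka0 m p : (0 < R)%N -> strict (fun i => p i) ->
  kostka R p 0 m = (p == staircase).
Proof.
move=> R_gt0 p_st; have in0 x : inside staircase x = false.
  by rewrite /inside ffunE /= ltnNge leq_addl.
case: eqP => [->|p_neq]; last first.
  apply: eq_card0 => T; rewrite inE; apply/negP => /andP[/boxtabP[_ Tp _ _] _].
  case: p_neq; apply: inside_inj => //; first exact: staircase_strict.
  by move=> x; rewrite in0 -Tp.
rewrite /kostka /= -[RHS](card1 [ffun _ : 'I_L * 'I_P => Ordinal R_gt0]); apply: eq_card => T.
rewrite !inE; apply/andP/eqP => [[/boxtabP[T_le _ _ _] _]|->].
  by apply/ffunP => x; apply/val_inj/eqP; rewrite ffunE -leqn0 T_le.
split; last by apply/forallP.
by apply/boxtabP; split=> [x|x|x y _ _|x y _ _]; rewrite ?ffunE ?in0.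
Qed.

(** Induction on the number of variables: branching rewrites the Kostka number of [p] as a sum over
    [q], and after exchanging the sums Pieri evaluates the sum over [p] to [a (m r)] times the
    determinant of [q]. *)
Lemma sum_jt_det_kostka r m N : (r < R)%N -> (N < L)%N ->
  \sum_(p : {ffun 'I_L -> 'I_P} | strictb p && (\sum_(i < L) p i == N + \sum_(i < L) i)%N)
    jt_det a (fun i => p i) * (kostka R p r m)%:R =
  if (\sum_(i < r) m i == N)%N then \prod_(i < r) a (m i) else 0.
Proof.
elim: r N => [|r IHr] N lt_rR lt_NL.
  rewrite !big_ord0; under eq_bigr => p /andP[/strictP p_st _] do rewrite kostka0 //.
  have [<-|N_neq0] := eqVneq 0%N N.
    rewrite (bigD1 staircase) /=; last first.
      apply/andP; split; first by apply/strictP; apply: staircase_strict.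
      by apply/eqP/eq_bigr => i _; rewrite ffunE.
    rewrite eqxx mulr1 jt_det_staircase big1 ?addr0 // => p /andP[_ /negbTE ->].
    by rewrite mulr0.
  rewrite big1 // => p /andP[_ sum_p]; case: eqP => [p_st|]; last by rewrite mulr0.
  case/negP: N_neq0; move: sum_p; rewrite p_st.
  have -> : (\sum_(i < L) staircase i = \sum_(i < L) i)%N.
    by apply: eq_bigr => i _; rewrite ffunE.
  by rewrite -{1}[X in X == _]add0n eqn_add2r.
under eq_bigr => p /andP[/strictP p_st _] do
  rewrite (kostka_branch _ lt_rR p_st) natr_sum mulr_sumr.
rewrite (exchange_big_dep (fun q => strictb q &&
  (\sum_(i < L) q i + m r == N + \sum_(i < L) i)%N)) /=; last first.
  move=> p q /andP[/strictP p_st /eqP <-] /andP[qp /eqP ->]; rewrite eqxx andbT.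
  by apply/strictP; apply: interlaces_strictl qp.
have [lt_N|le_N] := ltnP N (m r).
  rewrite big_pred0 => [|q].
    by rewrite big_ord_recr /= gtn_eqF // (leq_trans lt_N) ?leq_addl.
  apply/negP => /andP[/strictP/strict_sum_ge ge_q /eqP sum_q].
  by move: ge_q; rewrite -(leq_add2r (m r)) sum_q addnC leq_add2r leqNgt lt_N.
transitivity (\sum_(q : {ffun 'I_L -> 'I_P} | strictb q && (\sum_(i < L) q i == N - m r + \sum_(i < L) i)%N)
    a (m r) * (jt_det a (fun i => q i) * (kostka R q r m)%:R)).
  apply: eq_big => [q|q /andP[/strictP q_st /eqP sum_q]].
    by congr (_ && _); rewrite -[RHS](eqn_add2r (m r)) [in RHS]addnAC subnK.
  (* [q] encodes a partition with at most [N < L] cells, hence with an empty row, as Pieri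
     requires. *)
  have q0 : q ord0 = 0%N :> nat.
    apply: (strict_first0 q_st); rewrite [ltnRHS]addnC.
    by apply: leq_ltn_trans (leq_addr (m r) _) _; rewrite sum_q ltn_add2r.
  have lt_mP : (m r < P)%N by apply: leq_trans le_LP; apply: leq_ltn_trans lt_NL.
  rewrite mulrA -(jt_det_pieri a0 a_large q_st q0 lt_mP).
  rewrite mulr_suml; apply: eq_bigl => p.
  rewrite sum_q; case qp: (interlaces q p); rewrite ?andbF //= -andbA andbb.
  by rewrite (introT (strictP p) (interlaces_strictr q_st qp)).
rewrite -mulr_sumr (IHr _ (ltnW lt_rR) (leq_ltn_trans (leq_subr _ _) lt_NL)).
rewrite !big_ord_recr /= -[X in _ = if _ == X then _ else _](subnK le_N) eqn_add2r.
by case: eqP => _; rewrite ?mulr0 // mulrC.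
Qed.

End KostkaSum.

(** * Schur polynomials *)

Lemma prod_mpolyX (C : nzRingType) (r : nat) (I : finType) (f : I -> 'I_r) :
  \prod_(x : I) 'X_(f x) = 'X_[[multinom #|[set x | f x == i]| | i < r]] :> {mpoly C[r]}.
Proof.
rewrite -(big_morph (fun m : 'X_{1..r} => 'X_[m] : {mpoly C[r]}) (mpolyXD C) (mpolyX0 _ C)).
congr 'X_[_]; apply/mnmP => i; rewrite mnm_sumE mnmE -sum1dep_card [RHS]big_mkcond.
by apply: eq_bigr => x _; rewrite mnm1E; case: eqP.
Qed.

Definition tableaux la r (m : 'X_{1..r}) : {set {ffun cell la -> 'I_r}} :=
  [set T | semistandard T && [forall i, #|[set x | T x == i]| == m i]].

Lemma mcoeff_schur (C : comNzRingType) la r (m : 'X_{1..r}) :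
  (schur C la r)@_m = #|tableaux la m|%:R.
Proof.
rewrite /schur raddf_sum /= -sum1_card natr_sum.
rewrite big_mkcond [RHS]big_mkcond; apply: eq_bigr => T _; rewrite inE.
case: (semistandard T) => //=; rewrite prod_mpolyX mcoeffX.
have -> : ([multinom #|[set x | T x == i]| | i < r] == m) =
    [forall i, #|[set x | T x == i]| == m i].
  apply/eqP/forallP => [<- i|E]; first by rewrite mnmE.
  by apply/mnmP => i; rewrite mnmE; apply/eqP.
by case: [forall i, _].
Qed.

Lemma cell_eq la (x y : cell la) : crow x = crow y -> ccol x = ccol y -> x = y.
Proof.
case: x y => [i j] [i' j']; rewrite /crow /ccol /= => /val_inj E; move: j'; rewrite -E.
by move=> j' /val_inj ->.
Qed.

Definition mexp r (m : 'X_{1..r}) (k : nat) : nat :=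
  oapp (fun i : 'I_r => m i) 0%N (insub k).

Lemma mexp_ord r (m : 'X_{1..r}) (i : 'I_r) : mexp m i = m i.
Proof. by rewrite /mexp valK. Qed.

(** * From cells of a diagram to the box *)

Section CellsToBox.
Variables (L P : nat) (p : {ffun 'I_L -> 'I_P}) (la : seq nat).
Hypothesis p_st : strict (fun i => p i).
Hypothesis le_size : (size la <= L)%N.
Hypothesis la_p : forall i : 'I_L, (nth 0%N la (rev_ord i) + i = p i)%N.

Let row_le (y : cell la) : (nth 0%N la (tag y) <= P)%N.
Proof.
have := ltn_ord (p (rev_ord (widen_ord le_size (tag y)))); rewrite -la_p rev_ordK => lt_P.
exact: leq_trans (leq_addr _ _) (ltnW lt_P).
Qed.

(** Rows are reversed, since a diagram lists its longest row first and the box its shortest. *)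
Definition box_of (y : cell la) : 'I_L * 'I_P :=
  (rev_ord (widen_ord le_size (tag y)), widen_ord (row_le y) (tagged y)).

Lemma box_of_row (y z : cell la) : ((box_of y).1 < (box_of z).1)%N = (crow z < crow y)%N.
Proof. by rewrite /= ltn_sub2lE ?ltnS //; apply: leq_trans (ltn_ord _) le_size. Qed.

Lemma box_of_row_eq (y z : cell la) : ((box_of y).1 == (box_of z).1) = (crow y == crow z).
Proof. by rewrite (inj_eq rev_ord_inj). Qed.

Lemma box_of_col (y : cell la) : (box_of y).2 = ccol y :> nat.
Proof. by []. Qed.

Lemma box_of_inj : injective box_of.
Proof.
move=> y z E; apply: cell_eq; first by apply/eqP; rewrite -box_of_row_eq E.
by rewrite -!box_of_col E.
Qed.

Lemma inside_box_of (y : cell la) : inside p (box_of y).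
Proof.
rewrite /inside -la_p ltn_add2r /=.
have -> : (L - (L - (tag y).+1).+1 = tag y)%N by have := ltn_ord (tag y); lia.
exact: (ltn_ord (tagged y)).
Qed.

Lemma box_of_onto x : inside p x -> exists y, box_of y = x.
Proof.
case: x => i j; rewrite /inside -la_p ltn_add2r => lt_j.
have lt_i : (rev_ord i < size la)%N.
  by rewrite ltnNge; apply/negP => ge_i; rewrite nth_default in lt_j.
exists (Tagged (fun i : 'I_(size la) => 'I_(nth 0%N la i)) (i := Ordinal lt_i) (Ordinal lt_j)).
congr pair; apply: val_inj => //=.
by rewrite subnSK ?ltn_ord // subKn // ltnW.
Qed.

Variables (r : nat) (m : 'X_{1..r}).

(** Boxes outside the diagram receive [ord_max], that is, the filler [r]. *)
Let fill (T : {ffun cell la -> 'I_r}) : {ffun 'I_L * 'I_P -> 'I_r.+1} :=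
  [ffun x => if [pick y | box_of y == x] is Some y then widen_ord (leqnSn r) (T y) else ord_max].

Let fillE T y : fill T (box_of y) = T y :> nat.
Proof.
rewrite ffunE; case: pickP => [z /eqP/box_of_inj -> //|/(_ y)].
by rewrite eqxx.
Qed.

Let fill_out T x : ~~ inside p x -> fill T x = r :> nat.
Proof.
by rewrite ffunE; case: pickP => // y /eqP <-; rewrite inside_box_of.
Qed.

Let fill_inj : injective fill.
Proof.
move=> T T' E; apply/ffunP => y; apply/val_inj.
by rewrite /= -!fillE E.
Qed.

Let fill_content T :
  content r (mexp m) (fill T) = [forall i, #|[set x | T x == i]| == m i].
Proof.
have cE (i : 'I_r) : #|[set x | fill T x == i :> nat]| = #|[set x | T x == i]|.
  rewrite -(card_imset _ box_of_inj); apply: eq_card => x; rewrite !inE.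
  apply/eqP/imsetP => [E|[y + ->]]; last by rewrite inE fillE => /eqP ->.
  have [/box_of_onto[y y_x]|out] := boolP (inside p x); last first.
    by have := ltn_ord i; rewrite -E fill_out // ltnn.
  by exists y; rewrite // inE -val_eqE /= -fillE y_x E.
apply/forallP/forallP => cT i.
  have /implyP/(_ (ltn_ord i)) := cT (widen_ord (leqnSn r) i).
  rewrite mexp_ord -cE; congr (_ == _).
apply/implyP => lt_ir; have := cT (Ordinal lt_ir); rewrite -cE -mexp_ord.
by congr (_ == _).
Qed.

Let fill_boxtab T : boxtab p r (fill T) = semistandard T.
Proof.
have in_fill x : (fill T x < r)%N = inside p x.
  have [/box_of_onto[y <-]|out] := boolP (inside p x); first by rewrite fillE ltn_ord.
  by rewrite fill_out // ltnn.
apply/boxtabP/forallP => [[_ _ T_row T_col] y|ssT].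
  apply/forallP => z; apply/andP; split; apply/implyP => /andP[/eqP E lt].
    by rewrite -!fillE; apply: (T_row (box_of y) (box_of z) _ lt); apply/eqP; rewrite box_of_row_eq E.
  rewrite -!fillE; apply: T_col; rewrite ?inside_box_of ?box_of_row //.
  by apply: val_inj; rewrite /= -!/(ccol _) E.
split=> // [x|x y E lt|x y E lt ins]; first by rewrite -ltnS.
- have [in_y|out] := boolP (inside p y); last by rewrite (fill_out _ out) -ltnS.
  have in_x : inside p x.
    by move: in_y; rewrite /inside E; apply: ltn_trans; rewrite ltn_add2r.
  have [[x' x'E] [y' y'E]] := (box_of_onto in_x, box_of_onto in_y).
  move: E lt; rewrite -x'E -y'E => /eqP; rewrite box_of_row_eq !fillE => E lt.
  by have /forallP/(_ y')/andP[/implyP + _] := ssT x'; rewrite E; apply.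
(* The row of [y] is at least as long as that of [x]. *)
have in_y : inside p y.
  have := strict_diff p_st (ltnW lt); move: ins; rewrite /inside E.
  by move: lt; lia.
have [[x' x'E] [y' y'E]] := (box_of_onto ins, box_of_onto in_y).
move: E lt; rewrite -x'E -y'E box_of_row !fillE => /(congr1 val) /= E lt.
have /forallP/(_ x')/andP[_ /implyP] := ssT y'; apply.
by rewrite lt andbT; apply/eqP/esym.
Qed.

Lemma card_tableaux : #|tableaux la m| = kostka r.+1 p r (mexp m).
Proof.
rewrite /kostka -(card_imset _ fill_inj); apply: eq_card => T'.
apply/imsetP/idP => [[T + ->]|]; rewrite inE; first by rewrite inE fill_boxtab fill_content.
case/andP => bT cT; have [T_le Tp _ _] := boxtabP _ _ _ bT.
have lt_r y : (T' (box_of y) < r)%N by rewrite Tp inside_box_of.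
pose T := [ffun y => Ordinal (lt_r y)].
have T'E : T' = fill T.
  apply/ffunP => x; apply/val_inj => /=.
  have [/box_of_onto[y <-]|out] := boolP (inside p x); first by rewrite fillE ffunE.
  by rewrite fill_out //; apply/eqP; rewrite eqn_leq T_le leqNgt Tp.
by exists T; rewrite // inE -fill_boxtab -fill_content -T'E bT.
Qed.

End CellsToBox.

(** The zeros of a nonincreasing list are at its end, where the default of [nth] replaces them. *)
Lemma nth_filter_gt0 (s : seq nat) i : sorted geq s ->
  nth 0%N [seq x <- s | (0 < x)%N] i = nth 0%N s i.
Proof.
elim: s i => //= x s IHs i x_s; have s_sorted := path_sorted x_s.
have [x0|x_gt0] := posnP x; last by case: i => //= i; apply: IHs.
have geq_trans : transitive geq by move=> u v w vu uw; apply: leq_trans vu.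
have E j : nth 0%N s j = 0%N.
  have [lt_j|] := ltnP j (size s); last exact: nth_default.
  apply/eqP; rewrite -leqn0 -x0.
  exact: (allP (order_path_min geq_trans x_s)) (mem_nth _ lt_j).
by rewrite IHs // E x0; case: i => [|i] /=.
Qed.

(** * Partitions from strict sequences *)

Section PartitionOf.
Variables (L P : nat).
Implicit Types p q : {ffun 'I_L -> 'I_P}.

Definition part_rows p : seq nat := [seq (p (rev_ord i) - rev_ord i)%N | i <- enum 'I_L].

(** Empty rows are dropped because [intpart] forbids zero parts; for strict [p] the result is a
    partition, so the default is not taken. *)
Definition part_of p : intpart :=
  insubd (exist _ [::] isT : intpart) [seq x <- part_rows p | (0 < x)%N].

Lemma nth_part_rows p (i : 'I_L) : nth 0%N (part_rows p) (rev_ord i) = (p i - i)%N.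
Proof.
by rewrite (nth_map i) ?size_enum_ord ?ltn_ord // nth_ord_enum rev_ordK.
Qed.

Lemma part_rows_sorted p : strict (fun i => p i) -> sorted geq (part_rows p).
Proof.
move=> p_st; apply/(sortedP 0%N) => i; rewrite size_map size_enum_ord => lt_i.
pose u := rev_ord (Ordinal lt_i); pose v := rev_ord (Ordinal (ltnW lt_i)).
have := nth_part_rows p u; have := nth_part_rows p v; rewrite !rev_ordK /= => -> ->.
have le_uv : (u <= v)%N by rewrite /= leq_sub2l.
have := strict_diff p_st le_uv; rewrite /geq /=; lia.
Qed.

Lemma val_part_of p : strict (fun i => p i) ->
  val (part_of p) = [seq x <- part_rows p | (0 < x)%N].
Proof.
move=> p_st; rewrite /part_of insubdK // unfold_in /is_intpart mem_filter andbT.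
apply: sorted_filter (part_rows_sorted p_st) => u v w vu uw; exact: leq_trans vu.
Qed.

Lemma size_part_of p : strict (fun i => p i) -> (size (val (part_of p)) <= L)%N.
Proof.
move=> p_st; rewrite val_part_of // size_filter; apply: leq_trans (count_size _ _) _.
by rewrite size_map size_enum_ord.
Qed.

Lemma nth_part_of p (i : 'I_L) : strict (fun i => p i) ->
  (nth 0%N (val (part_of p)) (rev_ord i) + i = p i)%N.
Proof.
move=> p_st; rewrite val_part_of // nth_filter_gt0 ?part_rows_sorted //.
by rewrite nth_part_rows subnK //; exact: (strict_ge i p_st).
Qed.

Lemma part_of_inj p q : strict (fun i => p i) -> strict (fun i => q i) ->
  part_of p = part_of q -> p = q.
Proof.
move=> p_st q_st E; apply/ffunP => i; apply/val_inj => /=.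
by rewrite -(nth_part_of i p_st) -(nth_part_of i q_st) E.
Qed.

End PartitionOf.

(** * The expansion of W *)

Section Expansion.
Variables (C : numClosedFieldType) (e n : nat).
Hypothesis e_gt0 : (0 < e)%N.
(** One row more than a partition of [n] can fill, so that Pieri applies; [P] is such that
    [P < k + L] means [n + L < k], where [coefW] is zero. *)
Local Notation L := n.+1.
Local Notation P := (L + L + n)%N.
Implicit Types p : {ffun 'I_L -> 'I_P}.

(* Truncated so that the rows of the Jacobi-Trudi matrix have finite support;
   the values that matter for partitions of [n] are kept. *)
Definition coefW (k : nat) : C := if (k <= n + L)%N then invfact C (e * k) else 0.

Lemma strict_bound p (i : 'I_L) : strict (fun i => p i) ->
  (\sum_(i < L) p i = n + \sum_(i < L) i)%N -> (p i <= n + L)%N.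
Proof.
move=> p_st sum_p; have : (\sum_(i < L) (p i - i) = n)%N.
  by rewrite sumnB ?sum_p ?addnK // => j _; exact: (strict_ge j p_st).
rewrite (bigD1 i) //= => /eqP; have := ltn_ord i; lia.
Qed.

(** Multiplying both index sequences by [e] keeps them strict and turns the entries into inverse
    factorials; by [strict_bound] the truncation is not met. *)
Lemma jt_det_coefW_ge0 p : strict (fun i => p i) ->
  (\sum_(i < L) p i = n + \sum_(i < L) i)%N -> 0 <= jt_det coefW (fun i => p i).
Proof.
move=> p_st sum_p.
suff -> : jt_det coefW (fun i => p i) =
    \det (fact_mx C (fun i : 'I_L => e * p i)%N (fun j => e * j)%N).
  by apply: det_fact_mx_ge0 => i j lt_ij; rewrite ltn_pmul2l //; apply: p_st.
congr (\det _); apply/matrixP => i j; rewrite !mxE /shifted leq_pmul2l //.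
case: ifP => // _; rewrite /coefW mulnBr ifT //.
exact: leq_trans (leq_subr _ _) (strict_bound i p_st sum_p).
Qed.

Definition shapes : {set {ffun 'I_L -> 'I_P}} :=
  [set p | strictb p && (\sum_(i < L) p i == n + \sum_(i < L) i)%N].

Lemma mcoeff_Wpoly_schur r (m : 'X_{1..r}) :
  (Wpoly C e n r)@_m =
  ((e * n)`!)%:R * \sum_(p in shapes)
    jt_det coefW (fun i => p i) * (schur C (val (part_of p)) r)@_m.
Proof.
rewrite mcoeff_Wpoly //.
have a0 : coefW 0 = 1 by rewrite /coefW muln0 /invfact fact0 invr1.
have a_large k : (P < k + L)%N -> coefW k = 0.
  by move=> lt_k; rewrite /coefW ifF //; lia.
have le_LP : (L <= P)%N by lia.
transitivity (((e * n)`!)%:R * \sum_(p in shapes)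
    jt_det coefW (fun i => p i) * (kostka r.+1 p r (mexp m))%:R); last first.
  congr (_ * _); apply: eq_bigr => p; rewrite inE => /andP[/strictP p_st _].
  rewrite mcoeff_schur (card_tableaux p_st (size_part_of p_st)) // => i.
  exact: nth_part_of.
rewrite (eq_bigl _ _ (in_set _)) (sum_jt_det_kostka a0 a_large le_LP) //.
have -> : (\sum_(i < r) mexp m i = mdeg m)%N.
  by rewrite mdegE; apply: eq_bigr => i _; rewrite mexp_ord.
case: eqP => [deg_m|]; last by rewrite mulr0.
congr (_ * _); rewrite natr_prod -prodfV; apply: eq_bigr => i _.
(* Each exponent is at most the degree [n], hence within the truncation. *)
rewrite mexp_ord /coefW ifT // -deg_m mdegE (bigD1 i) //=.
by rewrite -addnA leq_addr.
Qed.

(** The coefficient has to depend on the partition alone, so its strict sequence is rebuilt from the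
    parts. *)
Definition coef_of_part (la : intpart) : C :=
  ((e * n)`!)%:R * jt_det coefW (fun i : 'I_L => (nth 0%N (val la) (rev_ord i) + i)%N).

Lemma coef_of_partE p : strict (fun i => p i) ->
  coef_of_part (part_of p) = ((e * n)`!)%:R * jt_det coefW (fun i => p i).
Proof.
move=> p_st; congr (_ * \det _); apply/matrixP => i j.
by rewrite !mxE nth_part_of.
Qed.

End Expansion.

Theorem theorem1p1 (C : numClosedFieldType) (e n : nat) (e_gt0 : (0 < e)%N) :
  schur_positive (W C e n e_gt0).
Proof.
have shapeP p : p \in shapes n ->
    strict (fun i => p i) /\ (\sum_(i < n.+1) p i = n + \sum_(i < n.+1) i)%N.
  by rewrite inE => /andP[/strictP ? /eqP].
pose parts := [fset part_of p | p in shapes n]%fset.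
exists [fsfun la in parts => coef_of_part C e n la | 0]; split=> [r|la]; last first.
  rewrite fsfunE; case: ifP => // /imfsetP[p /= /shapeP[p_st sum_p] ->].
  by rewrite coef_of_partE // mulr_ge0 ?jt_det_coefW_ge0.
(* Some coefficients may vanish, so the support can be smaller than [parts]; enlarging the sum adds
   only zero terms. *)
rewrite (big_fset_incl _ (finsupp_sub _ _ _)) => [|la _]; last first.
  by rewrite mem_finsupp negbK => /eqP ->; rewrite scale0r.
rewrite big_imfset /=; last first.
  by move=> p q /shapeP[p_st _] /shapeP[q_st _]; apply: part_of_inj.
rewrite big_enum /=.
apply/mpolyP => m; rewrite mcoeff_Wpoly_schur // mulr_sumr raddf_sum /=.
apply: eq_bigr => p p_shape; have [p_st sum_p] := shapeP p p_shape.
rewrite mcoeffZ fsfunE ifT; last by apply/imfsetP; exists p.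
by rewrite coef_of_partE // mulrA.
Qed.
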